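(* If $G$ is a connected graph and $d\ge 2$ is an integer, then $\mathrm{gp}_d(G)\ge\omega(G_{\mathrm{SR}}^d)$, where $G_{\mathrm{SR}}^d$ is the strong $d$-resolving graph of $G$ and $\omega$ denotes the clique number.
   Context: Graphs are finite, simple, undirected. $d_G(u,w)$ denotes the shortest-path distance in $G$, and $I_G(u,w)=\{x\in V(G): d_G(u,w)=d_G(u,x)+d_G(x,w)\}$. A set $S\subseteq V(G)$ is a general $d$-position set if for any three distinct vertices $u,v,w\in S$ with $v\in I_G(u,w)$ we have $d_G(u,w)>d$. $\mathrm{gp}_d(G)$ is the cardinality of a largest general $d$-position set of $G$. A vertex $u$ of a connected graph $G$ is maximally distant from a vertex $v$ if every neighbor $w$ of $u$ satisfies $d_G(v,w)\le d_G(u,v)$. If $u$ is maximally distant from $v$ and $v$ is maximally distant from $u$, then $u$ and $v$ are mutually maximally distant (MMD). For an integer $d\ge 2$, the strong $d$-resolving graph $G_{\mathrm{SR}}^d$ has vertex set $V(G)$, and two (distinct) vertices $u,v$ are adjacent in $G_{\mathrm{SR}}^d$ if either $u,v$ are MMD in $G$, or $d_G(u,v)\ge d$. *)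

(* Defs.v *)
From mathcomp Require Import all_boot.

Set Implicit Arguments.
Unset Strict Implicit.
Unset Printing Implicit Defensive.

Section Graphs.
Variables (T : finType) (e : rel T).

Definition simple_graph : Prop := symmetric e /\ irreflexive e.

(* The graph without vertices is not counted as connected. *)
Definition connected_graph : Prop :=
  0 < #|T| /\ (forall x y : T, connect e x y).

Definition has_path_of_length (u w : T) (n : nat) : bool :=
  [exists p : n.-tuple T, [&& path e u p, last u p == w & uniq (u :: p)]].

(* A path has at most #|T| - 1 edges, so this is the least n for which there   *)
(* is a u-w path with n edges; it is #|T| when no u-w path exists.             *)
Definition dist (u w : T) : nat :=
  find (has_path_of_length u w) (iota 0 #|T|).

Definition interval (u w : T) : {set T} :=
  [set x | dist u w == dist u x + dist x w].

Definition general_position (d : nat) (S : {set T}) : bool :=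
  [forall u in S, forall v in S, forall w in S,
    [&& u != v, v != w, u != w & v \in interval u w] ==> (d < dist u w)].

Definition gp (d : nat) : nat :=
  \max_(S : {set T} | general_position d S) #|S|.

Definition maximally_distant (u v : T) : bool :=
  [forall w, e u w ==> (dist v w <= dist u v)].

Definition mmd (u v : T) : bool :=
  maximally_distant u v && maximally_distant v u.

Definition strong_resolving (d : nat) : rel T :=
  fun u v => (u != v) && (mmd u v || (d <= dist u v)).

Definition clique (S : {set T}) : bool :=
  [forall u in S, forall v in S, (u != v) ==> e u v].

Definition clique_number : nat := \max_(S : {set T} | clique S) #|S|.

End Graphs.

(* Main.v *)
Require Import Defs.
From mathcomp Require Import all_boot.

(** The inequality holds because every clique [S] of the strong [d]-resolving
    graph is itself a general [d]-position set.  Suppose that [v] lies between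
    [u] and [w] on a geodesic, all three being distinct members of [S], and
    that [d(u, w) <= d].  Then [d(u, v) < d], so the adjacency of [u] and [v]
    in the resolving graph can only come from their being mutually maximally
    distant.  But the neighbour [x] of [v] that follows [v] on a geodesic
    towards [w] is strictly farther from [u] than [v] is, by the triangle
    inequality ([geodesic_not_maximally_distant]): [v] is not maximally
    distant from [u], a contradiction.

    What this uses of the distance is that it bounds the length of every path
    from below ([dist_le_size]) and is attained by some path ([dist_path]). *)

Section Distance.
Set Implicit Arguments.
Unset Strict Implicit.

Variables (T : finType) (e : rel T).

(** Removing the loops of an arbitrary path gives a simple path that is no
    longer, and short enough to be among the lengths that [dist] searches. *)
Lemma dist_le_size (u : T) (p : seq T) :
  path e u p -> dist e u (last u p) <= size p.
Proof.
case/shortenP=> q path_q uniq_q sub_qp.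
have q_small : size q < #|T|.
  by have := max_card (mem (u :: q)); rewrite (card_uniqP uniq_q).
have q_le_p : size q <= size p.
  apply: uniq_leq_size; first by case/andP: uniq_q.
  by move=> x; apply: sub_qp.
apply: leq_trans q_le_p; rewrite leqNgt; apply/negP=> lt_q_dist.
have := before_find 0 lt_q_dist; rewrite nth_iota // add0n.
by move/negbT/existsP; apply; exists (in_tuple q); rewrite path_q eqxx.
Qed.

(** The search in [dist] succeeds on connected vertices, so the distance is the
    length of an actual path: a geodesic. *)
Lemma dist_path (u w : T) :
  connect e u w ->
  exists p, [/\ path e u p, last u p = w & size p = dist e u w].
Proof.
case/connectP=> p0 path_p0 ->.
case/shortenP: path_p0 => q path_q uniq_q _.
have q_small : size q < #|T|.
  by have := max_card (mem (u :: q)); rewrite (card_uniqP uniq_q).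
have has_len : has (has_path_of_length e u (last u q)) (iota 0 #|T|).
  apply/hasP; exists (size q); first by rewrite mem_iota.
  by apply/existsP; exists (in_tuple q); rewrite path_q eqxx.
have := nth_find 0 has_len.
rewrite nth_iota; last by move: has_len; rewrite has_find size_iota.
case/existsP=> p /and3P[path_p /eqP last_p _].
by exists p; rewrite size_tuple.
Qed.

Lemma dist0_eq (u w : T) : connect e u w -> dist e u w = 0 -> u = w.
Proof. by case/dist_path=> p [_ <- <-] /size0nil->. Qed.

Lemma dist_triangle (u v w : T) :
  connect e u v -> connect e v w -> dist e u w <= dist e u v + dist e v w.
Proof.
move=> /dist_path[p [path_p last_p <-]] /dist_path[q [path_q last_q <-]].
rewrite -size_cat.
have := @dist_le_size u (p ++ q).
by rewrite cat_path last_cat last_p last_q path_p path_q; apply.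
Qed.

Lemma dist_sym_le (u w : T) :
  symmetric e -> connect e u w -> dist e w u <= dist e u w.
Proof.
move=> sym_e /dist_path[p [path_p <- <-]].
have path_rev : path e (last u p) (rev (belast u p)).
  by rewrite rev_path (eq_path (e' := e)) // => x y; rewrite sym_e.
have := dist_le_size path_rev.
suff -> : last (last u p) (rev (belast u p)) = u by rewrite size_rev size_belast.
by case: (p) => [|x q] //=; rewrite rev_cons last_rcons.
Qed.

Lemma dist_sym (u w : T) :
  symmetric e -> connect e u w -> dist e u w = dist e w u.
Proof.
move=> sym_e uw; apply/eqP; rewrite eqn_leq !dist_sym_le //.
by rewrite (sym_connect_sym sym_e).
Qed.

(** A geodesic from [u] that passes through [v] and goes on moves away from
    [u] at its next vertex, which is a neighbour of [v]. *)
Lemma geodesic_not_maximally_distant (u v w : T) :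
    symmetric e -> (forall x y, connect e x y) ->
  v != w -> v \in interval e u w -> ~~ maximally_distant e v u.
Proof.
move=> sym_e conn v_neq_w; rewrite inE => /eqP geo.
have [[|x p] [/= path_vp last_p size_p]] := dist_path (conn v w).
  by rewrite last_p eqxx in v_neq_w.
case/andP: path_vp => e_vx path_p.
apply/negP=> /forallP/(_ x); rewrite e_vx /= (dist_sym sym_e (conn v u)).
have dist_xw : dist e x w <= size p by rewrite -last_p dist_le_size.
have := leq_trans (dist_triangle (conn u x) (conn x w))
                  (leq_add (leqnn _) dist_xw).
by rewrite geo -size_p addnS -addSn leq_add2r ltnNge => /negP.
Qed.

(** Positive distance from [v] to [w] makes [d(u, v)] strictly smaller than
    [d(u, w)], which rules out adjacency by distance between [u] and [v];
    adjacency by maximal distance is ruled out by the geodesic itself. *)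
Lemma clique_strong_resolving_general_position (d : nat) (S : {set T}) :
    symmetric e -> (forall x y, connect e x y) ->
  clique (strong_resolving e d) S -> general_position e d S.
Proof.
move=> sym_e conn clique_S.
apply/forall_inP=> u uS; apply/forall_inP=> v vS; apply/forall_inP=> w wS.
apply/implyP=> /and4P[u_neq_v v_neq_w _ v_between].
rewrite ltnNge; apply/negP=> uw_le_d.
have dist_vw : 0 < dist e v w.
  by rewrite lt0n; apply: contra v_neq_w => /eqP/(dist0_eq (conn v w))->.
have uv_lt_d : dist e u v < d.
  apply: leq_trans uw_le_d; move: v_between; rewrite inE => /eqP->.
  by rewrite -addn1 leq_add2l.
have /forall_inP/(_ _ uS)/forall_inP/(_ _ vS) := clique_S.
rewrite u_neq_v /= /strong_resolving u_neq_v /= [d <= _]leqNgt uv_lt_d orbF.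
case/andP=> _ v_max.
by have /negP := geodesic_not_maximally_distant sym_e conn v_neq_w v_between.
Qed.

End Distance.

Theorem theorem5p2 (T : finType) (e : rel T) (d : nat)
    (simple_e : simple_graph e) (connected_e : connected_graph e)
    (d_ge2 : 2 <= d) :
  clique_number (strong_resolving e d) <= gp e d.
Proof.
case: simple_e connected_e => sym_e _ [_ conn].
apply/bigmax_leqP=> S clique_S; apply: leq_bigmax_cond.
exact: clique_strong_resolving_general_position.
Qed.
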